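(* Let $V=\mathbb{C}^N$ be graded by a parity function $i\mapsto[i]\in\{0,1\}$, let $R\in\mathrm{End}(V)\otimes\mathrm{End}(V)$ be an even R-matrix, $S=PR$, and let $A\in\mathrm{End}(V)$ be an arbitrary (not necessarily even) matrix. Then $A$ satisfies the graded reflection equation $$SA_2SA_2=A_2SA_2S\quad\text{in the graded tensor product } \mathrm{End}(V)\otimes\mathrm{End}(V)$$ if and only if $A$ satisfies the non-graded reflection equation $$\hat SA_2\hat SA_2=A_2\hat SA_2\hat S\quad\text{in } \mathrm{End}(V\otimes V),$$ where $\hat S^{ij}_{kl}=(-1)^{[i][j]+[k][l]}\,\breve S^{ij}_{kl}$. Moreover, if $A$ is even, then the graded reflection equation is equivalent to the non-graded reflection equation with $\hat S^{ij}_{kl}=\breve S^{ij}_{kl}$.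
   Context: $V$ has basis $v_1,\dots,v_N$; $e_{ij}v_k=\delta_{jk}v_i$, and $\mathrm{End}(V)$ is $\mathbb{Z}_2$-graded by $\deg e_{ij}=[i]+[j]\bmod 2$; even means of degree $0$. The graded tensor product $\mathrm{End}(V)\otimes\mathrm{End}(V)$ has multiplication $(a_1\otimes b_1)(a_2\otimes b_2)=(-1)^{\deg(a_2)\deg(b_1)}a_1a_2\otimes b_1b_2$ on homogeneous elements. An R-matrix is an invertible element $R=\sum R_{ij,lk}\,e_{ij}\otimes e_{lk}$ of this graded tensor product satisfying the Yang-Baxter equation $R_{12}R_{13}R_{23}=R_{23}R_{13}R_{12}$ in the graded tensor cube of $\mathrm{End}(V)$. The graded permutation is $P=\sum_{i,j}(-1)^{[j]}e_{ij}\otimes e_{ji}$. Define $\breve R^{ij}_{kl}=(-1)^{[i][j]+[j][k]+[k][l]}R_{ik,jl}$ and $\breve S^{ij}_{kl}=\breve R^{ji}_{kl}$. An array $F^{ij}_{kl}$ is identified with the operator $F\in\mathrm{End}(V\otimes V)$ given by $F(v_k\otimes v_l)=\sum_{i,j}F^{ij}_{kl}\,v_i\otimes v_j$ (ordinary, non-graded tensor product). In the graded equation $A_2=1\otimes A$ in the graded tensor product; in the non-graded equation $A_2=\mathrm{id}\otimes A$ is the ordinary operator $v_k\otimes v_l\mapsto v_k\otimes Av_l$. *)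

(* Defs.v *)
From HB Require Import structures.
From mathcomp Require Export all_boot all_order all_algebra.
From mathcomp Require Export complex mxtens.
From mathcomp Require Export reals.
From mathcomp Require Import ring.
Set Implicit Arguments.
Unset Strict Implicit.
Unset Printing Implicit Defensive.
Import GRing.Theory.
Local Open Scope ring_scope.

Reserved Notation "x *g y" (at level 40, left associativity).
Reserved Notation "x \ox y" (at level 35, no associativity).

(* Z/2-graded algebra given by its structure constants in a finite homogeneous
   basis. Associativity and unit laws are not recorded: only [sEnd] and its
   graded tensor powers are used. *)
Record superalg (K : comNzRingType) := SuperAlg {
  sbasis : finType;
  sdeg : sbasis -> bool;   (* [true] is degree 1 *)
  smulb : sbasis -> sbasis -> {ffun sbasis -> K^o};
  sone : {ffun sbasis -> K^o} }.

Section SuperAlgebra.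
Variable K : comNzRingType.

(* Coordinates in the basis [sbasis E]. *)
Definition selt (E : superalg K) := {ffun sbasis E -> K^o}.

Definition svec (E : superalg K) (b : sbasis E) : selt E := [ffun c => (c == b)%:R].

Definition smul (E : superalg K) (x y : selt E) : selt E :=
  \sum_(b : sbasis E) \sum_(c : sbasis E) (x b * y c) *: smulb b c.

Definition shomog (E : superalg K) (d : bool) (x : selt E) : Prop :=
  forall b : sbasis E, x b != 0 -> sdeg b = d.

Definition seven (E : superalg K) (x : selt E) : Prop := shomog false x.

Definition sunit (E : superalg K) (x : selt E) : Prop :=
  exists y : selt E, smul x y = sone E /\ smul y x = sone E.

Section Tensor.
Variables E F : superalg K.

Definition tensor_coord (x : selt E) (y : selt F) :
  {ffun sbasis E * sbasis F -> K^o} := [ffun b => x b.1 * y b.2].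

Definition stensor : superalg K :=
  @SuperAlg K (sbasis E * sbasis F)%type
    (fun b => sdeg b.1 (+) sdeg b.2)
    (fun b c => (-1) ^+ (sdeg c.1 * sdeg b.2)%N *:
       tensor_coord (smulb b.1 c.1) (smulb b.2 c.2))
    (tensor_coord (sone E) (sone F)).

Definition tens (x : selt E) (y : selt F) : selt stensor := tensor_coord x y.

End Tensor.
End SuperAlgebra.

Notation "x *g y" := (smul x y) : ring_scope.
Notation "x \ox y" := (tens x y) : ring_scope.

Fact sum_pair (W : nmodType) (I J : finType) (f : I * J -> W) :
  \sum_p f p = \sum_i \sum_j f (i, j).
Proof. by rewrite pair_bigA; apply: eq_bigr => -[]. Qed.

Fact sum_stensor (K : comNzRingType) (E F : superalg K) (W : nmodType)
    (f : sbasis (stensor E F) -> W) :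
  \sum_p f p = \sum_i \sum_j f (i, j).
Proof. exact: (sum_pair (I := sbasis E) (J := sbasis F) f). Qed.

(* Bilinearity extends the sign rule from basis vectors to homogeneous
   elements. *)
Lemma smul_tens (K : comNzRingType) (E F : superalg K)
  (a1 a2 : selt E) (b1 b2 : selt F) (da db : bool) :
  shomog da a2 -> shomog db b1 ->
  (a1 \ox b1) *g (a2 \ox b2) =
    (-1) ^+ (da * db)%N *: ((a1 *g a2) \ox (b1 *g b2)).
Proof.
move=> ha hb; apply/ffunP=> -[u v]; rewrite /smul !ffunE !sum_ffunE.
under eq_bigr => b _ do rewrite sum_ffunE.
under [X in _ = _ *: (X * _)]eq_bigr => b _ do rewrite sum_ffunE.
under [X in _ = _ *: (_ * X)]eq_bigr => b _ do rewrite sum_ffunE.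
rewrite sum_stensor mulr_suml scaler_sumr; apply: eq_bigr => p _.
rewrite (eq_bigr _ (fun q _ => sum_stensor _)) /=.
rewrite exchange_big mulr_suml scaler_sumr; apply: eq_bigr => r _ /=.
rewrite mulr_sumr scaler_sumr; apply: eq_bigr => q _.
rewrite mulr_sumr scaler_sumr; apply: eq_bigr => s _.
rewrite !ffunE /= /GRing.scale /=.
have [->|na] := eqVneq (a2 r) 0; first by rewrite !(mul0r, mulr0).
have [->|nb] := eqVneq (b1 q) 0; first by rewrite !(mul0r, mulr0).
rewrite (ha _ na) (hb _ nb); ring.
Qed.

Section EndV.
Variables (K : comNzRingType) (N : nat) (par : 'I_N -> bool).

(* End(V): the basis vector (i, j) is the matrix unit e_ij. *)
Definition sEnd : superalg K :=
  @SuperAlg K ('I_N * 'I_N)%type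
    (fun b => par b.1 (+) par b.2)
    (fun b c => [ffun d => ((b.2 == c.1) && (d == (b.1, c.2)))%:R])
    [ffun d => (d.1 == d.2)%:R].

Definition sEnd2 : superalg K := stensor sEnd sEnd.
Definition sEnd3 : superalg K := stensor sEnd2 sEnd.

Definition of_mx (A : 'M[K]_N) : selt sEnd := [ffun b => A b.1 b.2].

Definition eu (i j : 'I_N) : selt sEnd := svec (E := sEnd) (i, j).

(* Coefficient X_{ij,lk} of e_ij \ox e_lk. *)
Definition coef2 (X : selt sEnd2) (i j l k : 'I_N) : K := X ((i, j), (l, k)).

Definition leg12 (X : selt sEnd2) : selt sEnd3 :=
  \sum_i \sum_j \sum_l \sum_k
    coef2 X i j l k *: ((eu i j \ox eu l k) \ox sone sEnd).
Definition leg13 (X : selt sEnd2) : selt sEnd3 :=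
  \sum_i \sum_j \sum_l \sum_k
    coef2 X i j l k *: ((eu i j \ox sone sEnd) \ox eu l k).
Definition leg23 (X : selt sEnd2) : selt sEnd3 :=
  \sum_i \sum_j \sum_l \sum_k
    coef2 X i j l k *: ((sone sEnd \ox eu i j) \ox eu l k).

Definition yang_baxter (X : selt sEnd2) : Prop :=
  leg12 X *g leg13 X *g leg23 X = leg23 X *g leg13 X *g leg12 X.

Definition Rmatrix (X : selt sEnd2) : Prop := sunit X /\ yang_baxter X.

Definition gperm : selt sEnd2 :=
  \sum_i \sum_j (-1) ^+ (par j) *: (eu i j \ox eu j i).

Definition graded_reflection (S : selt sEnd2) (A : 'M[K]_N) : Prop :=
  let A2 : selt sEnd2 := sone sEnd \ox of_mx A in
  S *g A2 *g S *g A2 = A2 *g S *g A2 *g S.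

(* Arrays F^{ij}_{kl} are functions of i j k l, in this order. *)
Definition array := 'I_N -> 'I_N -> 'I_N -> 'I_N -> K.

(* Matrix, acting on column vectors, of
   v_k (x) v_l |-> \sum_(i, j) F^{ij}_{kl} v_i (x) v_j,
   the basis of V (x) V being indexed by [mxtens_index]. *)
Definition op_of_array (F : array) : 'M[K]_(N * N) :=
  \matrix_(x, y) F (mxtens_unindex x).1 (mxtens_unindex x).2
                   (mxtens_unindex y).1 (mxtens_unindex y).2.

Definition reflection (F : array) (A : 'M[K]_N) : Prop :=
  let S := op_of_array F in
  let A2 : 'M[K]_(N * N) := (1%:M : 'M[K]_N) *t A in
  S *m A2 *m S *m A2 = A2 *m S *m A2 *m S.

Definition Rbreve (X : selt sEnd2) : array := fun i j k l =>
  (-1) ^+ (par i * par j + par j * par k + par k * par l)%N * coef2 X i k j l.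

Definition Sbreve (X : selt sEnd2) : array := fun i j k l => Rbreve X j i k l.

Definition Shat (X : selt sEnd2) : array := fun i j k l =>
  (-1) ^+ (par i * par j + par k * par l)%N * Sbreve X i j k l.

End EndV.

Lemma of_mxM (K : comNzRingType) (N : nat) (par : 'I_N -> bool) (A B : 'M[K]_N) :
  of_mx par (A *m B) = of_mx par A *g of_mx par B.
Proof.
apply/ffunP=> -[i j]; rewrite /smul !ffunE sum_ffunE mxE /=.
under [RHS]eq_bigr => b _ do rewrite sum_ffunE.
rewrite (sum_pair (I := 'I_N) (J := 'I_N)) [RHS](bigD1 i) //=.
rewrite [X in _ = _ + X]big1 ?addr0.
  apply: eq_bigr => k _; rewrite (bigD1 (k, j)) //= big1 ?addr0.
    by rewrite !ffunE /= !eqxx /GRing.scale /= mulr1.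
  move=> [c d]; rewrite xpair_eqE => ncd; rewrite !ffunE /= xpair_eqE eqxx /=.
  by rewrite [k == c]eq_sym [j == d]eq_sym (negPf ncd) scaler0.
move=> a ai; apply: big1 => b _; apply: big1 => -[c d] _.
by rewrite !ffunE /= xpair_eqE [i == a]eq_sym (negPf ai) andbF scaler0.
Qed.

(* Main.v *)
Require Import Defs.
From mathcomp Require Import ring.
Set Implicit Arguments.
Unset Strict Implicit.
Unset Printing Implicit Defensive.
Import GRing.Theory.
Local Open Scope ring_scope.
Local Open Scope complex_scope.

(** The graded tensor square of End(V) is a matrix algebra in disguise: it acts
    faithfully on the vector space V (x) V once moving b past v costs its sign,
      (a (x) b)(v (x) w) = (-1)^(deg b * deg v) (a v) (x) (b w),
    so that e_ij (x) e_lk goes to (-1)^(([l]+[k])[j]) times the ordinary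
    E_ij (x) E_lk.  This map, [graded_op], is multiplicative and injective
    ([graded_op_mul], [graded_op_inj]), hence the graded reflection equation for
    S is an ordinary matrix equation between the images of S and A_2.

    It remains to identify these images.  The image of S = P R is exactly the
    operator of [Sbreve] ([graded_op_gperm_mul]).  The image of A_2 sends
    v_j (x) v_k to the sum over l of (-1)^(([l]+[k])[j]) A_lk v_j (x) v_l.  If A
    is even, A_lk vanishes unless [l] = [k], so this is already id (x) A, which
    settles the even case.  In general the sign (-1)^([l][j] + [k][j]) is that of
    conjugation by the diagonal involution D : v_a (x) v_b |-> (-1)^([a][b])
    v_a (x) v_b; thus D conjugates the image of A_2 into id (x) A
    ([graded_op_A2]), and the same conjugation turns [Sbreve] into [Shat]
    ([sign_op_conj]).  Conjugating both sides of an equation by D does not change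
    its validity ([reflection_conj]). *)

Section GradedToOrdinary.
Variables (K : comNzRingType) (N : nat) (par : 'I_N -> bool).
Local Notation E := (sEnd K par).
Local Notation E2 := (sEnd2 K par).

Lemma sum_smulb_sEnd (f : sbasis E -> K) (b d : sbasis E) :
  \sum_c f c * (smulb b c d : K) = (b.1 == d.1)%:R * f (b.2, d.2).
Proof.
rewrite (bigD1 (b.2, d.2)) //= big1 ?addr0 => [|[c1 c2]].
  by rewrite ffunE /= eqxx -pair_eqE /= eqxx andbT eq_sym mulrC.
rewrite xpair_eqE ffunE -pair_eqE /= => cd.
by rewrite [b.2 == _]eq_sym andbCA [d.2 == _]eq_sym (negPf cd) andbF mulr0.
Qed.

Lemma sum_row_sEnd (f : sbasis E -> K) (i : 'I_N) :
  \sum_b (b.1 == i)%:R * f b = \sum_m f (i, m).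
Proof.
rewrite (sum_pair (I := 'I_N) (J := 'I_N)) (bigD1 i) //= [X in _ + X]big1.
  by rewrite addr0; apply: eq_bigr => m _; rewrite eqxx mul1r.
by move=> a /negPf ai; rewrite big1 // => m _; rewrite ai mul0r.
Qed.

(** Matrix multiplication in both factors; the sign comes from moving e_ln past
    e_mj. *)
Lemma coef2_mul (X Y : selt E2) i j l k :
  coef2 (X *g Y) i j l k =
  \sum_m \sum_n (-1) ^+ ((par m (+) par j) * (par l (+) par n))%N *
    (coef2 X i m l n * coef2 Y m j n k).
Proof.
rewrite /coef2 /smul sum_ffunE.
under eq_bigr => b _ do rewrite sum_ffunE.
(* The sums over m and n become sums over the two left-hand matrix units, which
   must lie in rows i and l. *)
rewrite sum_stensor -(sum_row_sEnd (fun b => \sum_n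
  (-1) ^+ ((par b.2 (+) par j) * (par l (+) par n))%N *
    (X (b, (l, n)) * Y ((b.2, j), (n, k))))).
apply: eq_bigr => b1 _.
rewrite -(sum_row_sEnd (fun b =>
  (-1) ^+ ((par b1.2 (+) par j) * (par l (+) par b.2))%N *
    (X (b1, b) * Y ((b1.2, j), (b.2, k))))) mulr_sumr.
apply: eq_bigr => b2 _.
pose g (c1 c2 : sbasis E) : K :=
  (-1) ^+ ((par c1.1 (+) par c1.2) * (par b2.1 (+) par b2.2))%N *
    (X (b1, b2) * Y (c1, c2)).
rewrite sum_stensor.
transitivity (\sum_c1 (\sum_c2 g c1 c2 * (smulb b2 c2 (l, k) : K))
                * (smulb b1 c1 (i, j) : K)).
  apply: eq_bigr => c1 _; rewrite mulr_suml; apply: eq_bigr => c2 _.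
  rewrite /g !ffunE /= /GRing.scale /=.
  have regroup (x u v w : K) : x * (u * (v * w)) = u * x * w * v by ring.
  exact: regroup.
under eq_bigr => c1 _ do rewrite sum_smulb_sEnd.
rewrite (sum_smulb_sEnd (fun c1 => (b2.1 == l)%:R * g c1 (b2.2, k))) /g /=.
by case: (b2.1 =P l) => [->|]; rewrite ?mul0r ?mulr0.
Qed.

(** The sign comes from moving the second factor e_lk past v_j before it acts on
    v_j (x) v_k. *)
Definition graded_array (X : selt E2) : array K N := fun i l j k =>
  (-1) ^+ ((par l (+) par k) * par j)%N * coef2 X i j l k.

Definition graded_op (X : selt E2) : 'M[K]_(N * N) :=
  op_of_array (graded_array X).

Lemma sum_mxtens_index (f : 'I_(N * N) -> K) :
  \sum_x f x = \sum_i \sum_j f (mxtens_index (i, j)).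
Proof.
rewrite (reindex (@mxtens_index N N)) /=; last first.
  by exists (@mxtens_unindex N N) => x _; rewrite (mxtens_indexK, mxtens_unindexK).
exact: sum_pair.
Qed.

Lemma op_of_arrayE (F : array K N) i j k l :
  op_of_array F (mxtens_index (i, j)) (mxtens_index (k, l)) = F i j k l.
Proof. by rewrite mxE !mxtens_indexK. Qed.

Lemma mxtens_matrixP (M M' : 'M[K]_(N * N)) :
  (forall i j k l, M (mxtens_index (i, j)) (mxtens_index (k, l)) =
                   M' (mxtens_index (i, j)) (mxtens_index (k, l))) -> M = M'.
Proof.
move=> eqM; apply/matrixP => x y.
rewrite -(mxtens_unindexK x) -(mxtens_unindexK y).
by case: (mxtens_unindex x) (mxtens_unindex y) => [i j] [k l].
Qed.

(** The map respects products because the sign rule makes it an action: with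
    d = [l]+[n] and e = [n]+[k], the total sign (-1)^((d + e)[j]) times
    (-1)^(([m]+[j])d) of the graded product equals (-1)^(d[m]) times (-1)^(e[j]),
    as d[j] occurs twice. *)
Lemma graded_op_mul (X Y : selt E2) :
  graded_op (X *g Y) = graded_op X *m graded_op Y.
Proof.
apply: mxtens_matrixP => i l j k; rewrite op_of_arrayE mxE sum_mxtens_index.
rewrite /graded_array coef2_mul mulr_sumr; apply: eq_bigr => m _.
rewrite mulr_sumr; apply: eq_bigr => n _; rewrite !op_of_arrayE /graded_array.
by case: (par l); case: (par k); case: (par j); case: (par m); case: (par n);
  rewrite /= ?(muln0, muln1, expr0, expr1); ring.
Qed.

Lemma graded_op_inj : injective graded_op.
Proof.
move=> X Y eqXY; apply/ffunP => -[[i j] [l k]].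
have /= := congr1 (fun M : 'M_(N * N) =>
  M (mxtens_index (i, l)) (mxtens_index (j, k))) eqXY.
by rewrite !op_of_arrayE; apply: (can_inj (signrMK _)).
Qed.

Lemma coef2_gperm i j l k :
  coef2 (gperm K par) i j l k = (-1) ^+ par j * ((l == j) && (k == i))%:R.
Proof.
rewrite /coef2 /gperm sum_ffunE (bigD1 i) //= [X in _ + X]big1 ?addr0.
  rewrite sum_ffunE (bigD1 j) //= [X in _ + X]big1 ?addr0.
    by rewrite !ffunE /= !xpair_eqE !eqxx /= mul1r.
  move=> b /negPf bj.
  by rewrite !ffunE /= !xpair_eqE [j == b]eq_sym bj andbF mul0r scaler0.
move=> a /negPf ai; rewrite sum_ffunE big1 // => b _.
by rewrite !ffunE /= !xpair_eqE [i == a]eq_sym ai mul0r scaler0.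
Qed.

(** P acts as the graded flip v_j (x) v_i |-> (-1)^([i][j]) v_i (x) v_j; this is
    the source both of the swap of upper indices in [Sbreve] and of the sign
    [i][j] in [Rbreve]. *)
Lemma graded_op_gperm_mul (X : selt E2) :
  graded_op (gperm K par *g X) = op_of_array (Sbreve X).
Proof.
apply: mxtens_matrixP => i l j k; rewrite !op_of_arrayE /graded_array coef2_mul.
rewrite (bigD1 l) //= [X in _ + X]big1 ?addr0; last first.
  move=> m /negPf ml; rewrite big1 // => n _.
  by rewrite coef2_gperm [l == m]eq_sym ml !(mul0r, mulr0).
rewrite (bigD1 i) //= [X in _ + X]big1 ?addr0; last first.
  by move=> n /negPf ni; rewrite coef2_gperm ni andbF !(mul0r, mulr0).
rewrite coef2_gperm !eqxx /= /Sbreve /Rbreve.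
by case: (par i); case: (par l); case: (par j); case: (par k);
  rewrite /= ?(muln0, muln1, expr0, expr1); ring.
Qed.

Definition sign_op : 'M[K]_(N * N) := diag_mx
  (\row_x (-1) ^+ (par (mxtens_unindex x).1 * par (mxtens_unindex x).2)%N).

(** The signs are those relating [Sbreve] to [Shat]. *)
Lemma sign_op_conj (F : array K N) :
  sign_op *m op_of_array F *m sign_op = op_of_array (fun i j k l =>
    (-1) ^+ (par i * par j + par k * par l)%N * F i j k l).
Proof.
apply/matrixP => x y; rewrite mul_diag_mx mul_mx_diag !mxE exprD.
by rewrite mulrAC.
Qed.

Lemma sign_op_sqr : sign_op *m sign_op = 1%:M.
Proof.
apply/matrixP => x y; rewrite mul_diag_mx !mxE.
by rewrite mulrnAr -expr2 sqrr_sign.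
Qed.

Lemma graded_array_A2 (A : 'M[K]_N) i l j k :
  graded_array (sone E \ox of_mx par A) i l j k =
  (-1) ^+ ((par l (+) par k) * par j)%N * ((i == j)%:R * A l k).
Proof. by rewrite /graded_array /coef2 !ffunE. Qed.

(** On the diagonal i = j of the first factor, the sign ([l]+[k])[j] of the action
    is the sign [i][l] + [j][k] of the conjugation, so the two cancel. *)
Lemma graded_op_A2 (A : 'M[K]_N) :
  sign_op *m graded_op (sone E \ox of_mx par A) *m sign_op = 1%:M *t A.
Proof.
rewrite sign_op_conj; apply: mxtens_matrixP => i l j k.
rewrite op_of_arrayE tensmxE graded_array_A2 !mxE.
have [->|] := eqVneq i j; last by rewrite !(mul0r, mulr0).
by case: (par j); case: (par l); case: (par k);
  rewrite /= ?(muln0, muln1, expr0, expr1); ring.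
Qed.

Lemma graded_op_even_A2 (A : 'M[K]_N) :
  seven (of_mx par A) -> graded_op (sone E \ox of_mx par A) = 1%:M *t A.
Proof.
move=> evA; apply: mxtens_matrixP => i l j k.
rewrite op_of_arrayE tensmxE graded_array_A2 !mxE.
have [->|nzA] := eqVneq (A l k) 0; first by rewrite !mulr0.
have /= -> := evA (l, k); first by rewrite mul1r.
by rewrite ffunE.
Qed.

Lemma graded_reflection_op (S : selt E2) (A : 'M[K]_N) :
  let s := graded_op S in let a := graded_op (sone E \ox of_mx par A) in
  graded_reflection S A <-> s *m a *m s *m a = a *m s *m a *m s.
Proof.
rewrite /graded_reflection /= -!graded_op_mul; split=> [-> //|].
exact: graded_op_inj.
Qed.

Lemma reflection_conj n (D s a : 'M[K]_n) : D *m D = 1%:M ->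
  let s' := D *m s *m D in let a' := D *m a *m D in
  s *m a *m s *m a = a *m s *m a *m s <->
  s' *m a' *m s' *m a' = a' *m s' *m a' *m s'.
Proof.
move=> DD /=.
have conjM x y : D *m x *m D *m (D *m y *m D) = D *m (x *m y) *m D.
  by rewrite !mulmxA -[_ *m D *m D]mulmxA DD mulmx1.
rewrite !conjM; split=> [-> //|].
move=> /(congr1 (fun x => D *m x *m D)).
by rewrite !mulmxA DD !mul1mx -![_ *m D *m D]mulmxA DD !mulmx1.
Qed.
End GradedToOrdinary.

Theorem proposition2p1 (R : realType) (N : nat) (par : 'I_N -> bool)
    (Rm : selt (sEnd2 R[i] par)) (Rm_Rmatrix : Rmatrix Rm) (Rm_even : seven Rm)
    (A : 'M[R[i]]_N) :
  (graded_reflection (gperm R[i] par *g Rm) A <-> reflection (Shat Rm) A) /\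
  (seven (of_mx par A) ->
   (graded_reflection (gperm R[i] par *g Rm) A <-> reflection (Sbreve Rm) A)).
Proof.
split=> [|evA]; rewrite graded_reflection_op graded_op_gperm_mul.
  rewrite (reflection_conj _ _ (sign_op_sqr _ par)) graded_op_A2 sign_op_conj.
  (* The conjugated array is [Shat Rm], by definition. *)
  by [].
by rewrite graded_op_even_A2.
Qed.
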